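(* Assume that the semidefinite program (SDP-E) defined in the context is feasible, that $\bar B_{k,\ell}=\mathbf 0$ for all $k\in\{0,\dots,N-1\}$ and $\ell\in\{1,\dots,M\}$, and that $A_k$ is invertible for all $k\in\{0,\dots,N-1\}$. Then the optimal values of the decision variables $\{L_k^\star,\Sigma_k^\star,\mathbf M_k^\star\}_{k=0}^{N-1}$ of (SDP-E), with $\Sigma_k^\star$ invertible for $k=0,\dots,N-1$, satisfy $$\mathbf M_k^\star=L_k^\star(\Sigma_k^\star)^{-1}(L_k^\star)^{\mathrm T}\qquad\text{for all }k\in\{0,\dots,N-1\}.$$
   Context: Notation: $\mathbb S_n^{+}$ and $\mathbb S_n^{++}$ are the sets of symmetric positive semidefinite and symmetric positive definite $n\times n$ real matrices; $A\succeq B$ means $A-B\in\mathbb S_n^+$; $\mathrm{tr}$ is the trace. Data: positive integers $N,M,n,m$; for $k=0,\dots,N-1$ and $\ell=1,\dots,M$, matrices $A_k,\bar A_{k,\ell}\in\mathbb R^{n\times n}$, $B_k,\bar B_{k,\ell}\in\mathbb R^{n\times m}$, vectors $d_k\in\mathbb R^n$, $W_k\in\mathbb S_n^+$, $R_k\in\mathbb S_m^{++}$, $Q_k\in\mathbb S_n^{++}$; and $\mu_0,\mu_{\mathrm d}\in\mathbb R^n$, $\Sigma_0,\Sigma_{\mathrm d}\in\mathbb S_n^{++}$. First step, semidefinite program (SDP-R): with $\mu_0,\Sigma_0$ fixed to the given data, the decision variables are $\bar u_k\in\mathbb R^m$, $L_k\in\mathbb R^{m\times n}$, symmetric $\mathbf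 M_k,\mathbf U_k\in\mathbb R^{m\times m}$, symmetric $\mathbf X_k\in\mathbb R^{n\times n}$ ($k=0,\dots,N-1$), and $\mu_k\in\mathbb R^n$, symmetric $\Sigma_k\in\mathbb R^{n\times n}$ ($k=1,\dots,N$). Minimize $$\sum_{k=0}^{N-1}\mathrm{tr}\big(R_k(\mathbf U_k+\mathbf M_k)\big)+\mathrm{tr}\big(Q_k(\Sigma_k+\mathbf X_k)\big)$$ subject to, for all $k=0,\dots,N-1$, $$\mu_{k+1}=A_k\mu_k+B_k\bar u_k+d_k,$$ $$\Sigma_{k+1}=A_k\Sigma_kA_k^{\mathrm T}+A_kL_k^{\mathrm T}B_k^{\mathrm T}+B_kL_kA_k^{\mathrm T}+B_k\mathbf M_kB_k^{\mathrm T}+W_k+\sum_{\ell=1}^M\bar B_{k,\ell}(\mathbf M_k+\mathbf U_k)\bar B_{k,\ell}^{\mathrm T}+\sum_{\ell=1}^M\bar A_{k,\ell}(\Sigma_k+\mathbf X_k)\bar A_{k,\ell}^{\mathrm T},$$ $$\begin{bmatrix}\mathbf M_k&L_k\\L_k^{\mathrm T}&\Sigma_k\end{bmatrix}\succeq\mathbf 0,\qquad\begin{bmatrix}\mathbf X_k&\mu_k\\\mu_k^{\mathrm T}&1\end{bmatrix}\succeq\mathbf 0,\qquad\begin{bmatrix}\mathbf U_k&\bar u_k\\\bar u_k^{\mathrm T}&1\end{bmatrix}\succeq\mathbf 0,$$ and $\mu_N=\mu_{\mathrm d}$, $\Sigma_{\mathrm d}\succeq\Sigma_N$. It is assumed that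 this program is feasible, and $\bar u_k^\star,\mu_k^\star$ denote the values of $\bar u_k,\mu_k$ in an optimal solution of it. Put $\mathbf U_k^\star=\bar u_k^\star(\bar u_k^\star)^{\mathrm T}$, $\mathbf X_k^\star=\mu_k^\star(\mu_k^\star)^{\mathrm T}$ and $$\mathbf H_k=W_k+\sum_{\ell=1}^M\big(\bar A_{k,\ell}\mathbf X_k^\star\bar A_{k,\ell}^{\mathrm T}+\bar B_{k,\ell}\mathbf U_k^\star\bar B_{k,\ell}^{\mathrm T}\big).$$ Second step, semidefinite program (SDP-E): with $\Sigma_0$ and the matrices $\mathbf H_k$ fixed, the decision variables are $L_k\in\mathbb R^{m\times n}$, symmetric $\mathbf M_k\in\mathbb R^{m\times m}$ ($k=0,\dots,N-1$) and symmetric $\Sigma_k\in\mathbb R^{n\times n}$ ($k=1,\dots,N$). Minimize $\sum_{k=0}^{N-1}\mathrm{tr}(R_k\mathbf M_k+Q_k\Sigma_k)$, read as $\sum_{k=0}^{N-1}\big(\mathrm{tr}(R_k\mathbf M_k)+\mathrm{tr}(Q_k\Sigma_k)\big)$, subject to, for all $k=0,\dots,N-1$, $$\Sigma_{k+1}=A_k\Sigma_kA_k^{\mathrm T}+A_kL_k^{\mathrm T}B_k^{\mathrm T}+B_kL_kA_k^{\mathrm T}+B_k\mathbf M_kB_k^{\mathrm T}+\mathbf H_k+\sum_{\ell=1}^M\big(\bar A_{k,\ell}\Sigma_k\bar A_{k,\ell}^{\mathrm T}+\bar B_{k,\ell}\mathbf M_k\bar B_{k,\ell}^{\mathrm T}\big),$$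 $$\begin{bmatrix}\mathbf M_k&L_k\\L_k^{\mathrm T}&\Sigma_k\end{bmatrix}\succeq\mathbf 0,$$ and $\Sigma_N=\Sigma_{\mathrm d}$. *)

(* Defs.v *)
From HB Require Import structures.
From mathcomp Require Import all_boot all_order all_algebra.
From mathcomp Require Import reals.

Set Implicit Arguments.
Unset Strict Implicit.
Unset Printing Implicit Defensive.

Import Order.TTheory GRing.Theory Num.Theory.
Local Open Scope ring_scope.

Definition symmx (R : realType) (n : nat) (A : 'M[R]_n) : Prop := A^T = A.

Definition psdmx (R : realType) (n : nat) (A : 'M[R]_n) : Prop :=
  symmx A /\ forall x : 'cV[R]_n, 0 <= (x^T *m A *m x) 0 0.

Definition pdmx (R : realType) (n : nat) (A : 'M[R]_n) : Prop :=
  symmx A /\ forall x : 'cV[R]_n, x != 0 -> 0 < (x^T *m A *m x) 0 0.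

(* [loewner_ge A B] is the Loewner order A >= B. *)
Definition loewner_ge (R : realType) (n : nat) (A B : 'M[R]_n) : Prop :=
  psdmx (A - B).

Definition minimizer (R : realType) (T : Type) (F : T -> Prop) (J : T -> R)
    (v : T) : Prop :=
  F v /\ forall w, F w -> J v <= J w.

(* States carry a time index in {0, ..., N}, everything else one in
   {0, ..., N-1}; for k : 'I_N, [now k] and [next k] are the indices k and
   k + 1 of the states before and after step k. *)
Definition now (N : nat) (k : 'I_N) : 'I_N.+1 := widen_ord (leqnSn N) k.
Definition next (N : nat) (k : 'I_N) : 'I_N.+1 := lift ord0 k.

Record steering_data (R : realType) (N M n m : nat) := SteeringData {
  sA : 'I_N -> 'M[R]_n;
  sAbar : 'I_N -> 'I_M -> 'M[R]_n;
  sB : 'I_N -> 'M[R]_(n, m);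
  sBbar : 'I_N -> 'I_M -> 'M[R]_(n, m);
  sd : 'I_N -> 'cV[R]_n;
  sW : 'I_N -> 'M[R]_n;
  sR : 'I_N -> 'M[R]_m;
  sQ : 'I_N -> 'M[R]_n;
  smu0 : 'cV[R]_n;
  smud : 'cV[R]_n;
  sSigma0 : 'M[R]_n;
  sSigmad : 'M[R]_n }.

Definition steering_data_wf (R : realType) (N M n m : nat)
    (D : steering_data R N M n m) : Prop :=
  [/\ forall k, psdmx (sW D k),
      forall k, pdmx (sR D k),
      forall k, pdmx (sQ D k),
      pdmx (sSigma0 D)
    & pdmx (sSigmad D)].

(* The prescribed initial values [smu0] and [sSigma0] are imposed on the
   index-0 entries of [rmu], [rSigma] and [eSigma] as equality constraints. *)
Record sdpR_vars (R : realType) (N n m : nat) := SdpRVars {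
  ru : 'I_N -> 'cV[R]_m;
  rL : 'I_N -> 'M[R]_(m, n);
  rM : 'I_N -> 'M[R]_m;
  rU : 'I_N -> 'M[R]_m;
  rX : 'I_N -> 'M[R]_n;
  rmu : 'I_N.+1 -> 'cV[R]_n;
  rSigma : 'I_N.+1 -> 'M[R]_n }.

Definition sdpR_cost (R : realType) (N M n m : nat)
    (D : steering_data R N M n m) (v : sdpR_vars R N n m) : R :=
  \sum_(k < N) (\tr (sR D k *m (rU v k + rM v k))
                + \tr (sQ D k *m (rSigma v (now k) + rX v k))).

Definition sdpR_step (R : realType) (N M n m : nat)
    (D : steering_data R N M n m) (v : sdpR_vars R N n m) (k : 'I_N) : Prop :=
  let A := sA D k in
  let B := sB D k in
  let L := rL v k in
  let Sigma := rSigma v (now k) in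
  let mu := rmu v (now k) in
  [/\ rmu v (next k) = A *m mu + B *m ru v k + sd D k,
      rSigma v (next k) =
        A *m Sigma *m A^T + A *m L^T *m B^T + B *m L *m A^T
        + B *m rM v k *m B^T + sW D k
        + \sum_(l < M) sBbar D k l *m (rM v k + rU v k) *m (sBbar D k l)^T
        + \sum_(l < M) sAbar D k l *m (Sigma + rX v k) *m (sAbar D k l)^T,
      psdmx (block_mx (rM v k) L L^T Sigma),
      psdmx (block_mx (rX v k) mu mu^T (1%:M : 'M[R]_1))
    & psdmx (block_mx (rU v k) (ru v k) (ru v k)^T (1%:M : 'M[R]_1))].

Definition sdpR_feasible (R : realType) (N M n m : nat)
    (D : steering_data R N M n m) (v : sdpR_vars R N n m) : Prop :=
  [/\ forall k, [/\ symmx (rM v k), symmx (rU v k) & symmx (rX v k)],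
      forall k, symmx (rSigma v k),
      rmu v ord0 = smu0 D /\ rSigma v ord0 = sSigma0 D,
      forall k, sdpR_step D v k
    & rmu v ord_max = smud D /\ loewner_ge (sSigmad D) (rSigma v ord_max)].

Definition sdpR_optimal (R : realType) (N M n m : nat)
    (D : steering_data R N M n m) (v : sdpR_vars R N n m) : Prop :=
  minimizer (sdpR_feasible D) (sdpR_cost D) v.

(* The rank-one matrices are built from the mean trajectory of [v]; they need
   not coincide with the relaxed variables [rX v] and [rU v]. *)
Definition steering_H (R : realType) (N M n m : nat)
    (D : steering_data R N M n m) (v : sdpR_vars R N n m) (k : 'I_N)
    : 'M[R]_n :=
  let X := rmu v (now k) *m (rmu v (now k))^T in
  let U := ru v k *m (ru v k)^T in
  sW D k + \sum_(l < M) (sAbar D k l *m X *m (sAbar D k l)^T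
                         + sBbar D k l *m U *m (sBbar D k l)^T).

Record sdpE_vars (R : realType) (N n m : nat) := SdpEVars {
  eL : 'I_N -> 'M[R]_(m, n);
  eM : 'I_N -> 'M[R]_m;
  eSigma : 'I_N.+1 -> 'M[R]_n }.

Definition sdpE_cost (R : realType) (N M n m : nat)
    (D : steering_data R N M n m) (v : sdpE_vars R N n m) : R :=
  \sum_(k < N) (\tr (sR D k *m eM v k) + \tr (sQ D k *m eSigma v (now k))).

Definition sdpE_step (R : realType) (N M n m : nat)
    (D : steering_data R N M n m) (H : 'I_N -> 'M[R]_n)
    (v : sdpE_vars R N n m) (k : 'I_N) : Prop :=
  let A := sA D k in
  let B := sB D k in
  let L := eL v k in
  let Sigma := eSigma v (now k) in
  eSigma v (next k) =
    A *m Sigma *m A^T + A *m L^T *m B^T + B *m L *m A^T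
    + B *m eM v k *m B^T + H k
    + \sum_(l < M) (sAbar D k l *m Sigma *m (sAbar D k l)^T
                    + sBbar D k l *m eM v k *m (sBbar D k l)^T)
  /\ psdmx (block_mx (eM v k) L L^T Sigma).

Definition sdpE_feasible (R : realType) (N M n m : nat)
    (D : steering_data R N M n m) (H : 'I_N -> 'M[R]_n)
    (v : sdpE_vars R N n m) : Prop :=
  [/\ forall k, symmx (eM v k),
      forall k, symmx (eSigma v k),
      eSigma v ord0 = sSigma0 D,
      forall k, sdpE_step D H v k
    & eSigma v ord_max = sSigmad D].

Definition sdpE_optimal (R : realType) (N M n m : nat)
    (D : steering_data R N M n m) (H : 'I_N -> 'M[R]_n)
    (v : sdpE_vars R N n m) : Prop :=
  minimizer (sdpE_feasible D H) (sdpE_cost D) v.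

(* Main.v *)
Require Import Defs.
From HB Require Import structures.
From mathcomp Require Import all_boot all_order all_algebra.
From mathcomp Require Import reals.
From mathcomp Require Import ring lra.

Set Implicit Arguments.
Unset Strict Implicit.
Unset Printing Implicit Defensive.

Import Order.TTheory GRing.Theory Num.Theory.
Local Open Scope ring_scope.

(** The statement is local in time and is proved without multipliers: if the
    relaxation is loose at a step [k], the variables of that step alone can be
    changed, with every covariance kept, so that the cost strictly drops.

    Drop the index [k], write [S] for the covariance and [K = L S^-1], and
    suppose that the Schur complement [V = M - L S^-1 L^T], which is positive
    semidefinite, is not zero. It is the covariance of an additional random
    part of the control, uncorrelated with the state. Then [V] dominates
    [d d^T] for some [d != 0] ([psdmx_neq0_rank1]). For any column [h], put
    [e = A^-1 B d] and
      [L' = L + h e^T],  [M' = M - (h d^T + d h^T)].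
    Since [A e = B d], the changes of [A L^T B^T + B L A^T] and of [B M B^T]
    cancel, so the next covariance is unchanged; this is where the
    invertibility of [A] enters, and also the absence of control-dependent
    noise, as otherwise [M] acts on the next covariance in a second way.

    It remains to choose [h]. With [y = d + K e] and [sg = e^T S^-1 e], the
    new Schur complement is
      [V - h y^T - y h^T - sg h h^T].
    If [sg > 0], setting [h + y / sg = (cos a) y / sg + (sin a) d / sqrt sg]
    rotates the pair [(y / sqrt sg, d)], which turns the rank-one part [d d^T]
    of [V] into another rank-one square and hence preserves positivity. In
    terms of [t = tan (a / 2) / sqrt sg] this reads
      [h = 2 t / (1 + sg t^2) (d - t y)],
    which makes sense for [sg = 0] too ([psdmx_rotate]). The cost changes by
    [- 2 d^T C h], where [C] is the positive definite control weight; this is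
    a positive multiple of [- (d^T C d - t d^T C y)], negative for small
    [t > 0] ([steering_step_improve]). *)

(** * Bilinear forms and positive semidefinite matrices *)

Definition bilmx (R : realType) (p q : nat) (A : 'M[R]_(p, q))
    (x : 'cV[R]_p) (y : 'cV[R]_q) : R := (x^T *m A *m y) 0 0.

Local Notation dot := (bilmx 1%:M).

Lemma bilmxDm (R : realType) p q (A B : 'M[R]_(p, q)) x y :
  bilmx (A + B) x y = bilmx A x y + bilmx B x y.
Proof. by rewrite /bilmx mulmxDr mulmxDl mxE. Qed.

Lemma bilmxNm (R : realType) p q (A : 'M[R]_(p, q)) x y :
  bilmx (- A) x y = - bilmx A x y.
Proof. by rewrite /bilmx mulmxN mulNmx mxE. Qed.

Lemma bilmxDl (R : realType) p q (A : 'M[R]_(p, q)) x1 x2 y :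
  bilmx A (x1 + x2) y = bilmx A x1 y + bilmx A x2 y.
Proof. by rewrite /bilmx linearD /= !mulmxDl mxE. Qed.

Lemma bilmxZl (R : realType) p q (A : 'M[R]_(p, q)) a x y :
  bilmx A (a *: x) y = a * bilmx A x y.
Proof. by rewrite /bilmx linearZ /= -!scalemxAl mxE. Qed.

Lemma bilmx_tr (R : realType) p q (A : 'M[R]_(p, q)) x y :
  bilmx A^T y x = bilmx A x y.
Proof.
by rewrite /bilmx -[RHS]trace_mx11 -mxtrace_tr !trmx_mul trmxK mulmxA
  trace_mx11.
Qed.

Lemma bilmxDr (R : realType) p q (A : 'M[R]_(p, q)) x y1 y2 :
  bilmx A x (y1 + y2) = bilmx A x y1 + bilmx A x y2.
Proof. by rewrite -!(bilmx_tr A) bilmxDl. Qed.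

Lemma bilmxZr (R : realType) p q (A : 'M[R]_(p, q)) a x y :
  bilmx A x (a *: y) = a * bilmx A x y.
Proof. by rewrite -!(bilmx_tr A) bilmxZl. Qed.

Lemma bilmx_mulr (R : realType) p q r (A : 'M[R]_(p, q))
    (B : 'M[R]_(q, r)) x y :
  bilmx (A *m B) x y = bilmx A x (B *m y).
Proof. by rewrite /bilmx !mulmxA. Qed.

Lemma bilmx_rank1 (R : realType) p q (u : 'cV[R]_p) (v : 'cV[R]_q) x y :
  bilmx (u *m v^T) x y = dot u x * dot v y.
Proof.
by rewrite -(bilmx_tr _ u) trmx1 /bilmx !mulmx1 mulmxA -mulmxA mxE big_ord1.
Qed.

Lemma bilmx_block (R : realType) p q (M : 'M[R]_p) (L : 'M[R]_(p, q))
    (S : 'M[R]_q) x xi :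
  bilmx (block_mx M L L^T S) (col_mx x xi) (col_mx x xi) =
  bilmx M x x + bilmx L x xi *+ 2 + bilmx S xi xi.
Proof.
rewrite mulr2n -{2}(bilmx_tr L) /bilmx tr_col_mx mul_row_block mul_row_col.
rewrite !mulmxDl !mxE; ring.
Qed.

Lemma bilmx_sym (R : realType) p (A : 'M[R]_p) x y :
  symmx A -> bilmx A x y = bilmx A y x.
Proof. by move=> symA; rewrite -bilmx_tr symA. Qed.

Lemma bilmx_ge0 (R : realType) p (A : 'M[R]_p) x : psdmx A -> 0 <= bilmx A x x.
Proof. by case=> _; exact. Qed.

Lemma mxtrace_rank1 (R : realType) p q (A : 'M[R]_(p, q)) x y :
  \tr (A *m (y *m x^T)) = bilmx A x y.
Proof. by rewrite mulmxA mxtrace_mulC mulmxA trace_mx11. Qed.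

(** The form is nonnegative on every [a x + b y]; the discriminant inequality
    is read off at [a = A(y, y)], [b = - A(x, y)], and when [A(y, y) = 0] the
    expression is affine in [b], which forces [A(x, y) = 0]. *)
Lemma psdmx_cauchy_schwarz (R : realType) p (A : 'M[R]_p) x y :
  psdmx A -> bilmx A x y ^+ 2 <= bilmx A x x * bilmx A y y.
Proof.
move=> psdA; have [symA _] := psdA.
have pos a b : 0 <= a ^+ 2 * bilmx A x x + a * b * bilmx A x y *+ 2
    + b ^+ 2 * bilmx A y y.
  have := bilmx_ge0 (a *: x + b *: y) psdA.
  rewrite !bilmxDl !bilmxDr !bilmxZl !bilmxZr (bilmx_sym y x symA).
  by congr (_ <= _); ring.
have Ax := bilmx_ge0 x psdA; have Ay := bilmx_ge0 y psdA.
move: (bilmx A x x) (bilmx A y y) (bilmx A x y) pos Ax Ay => u v w pos u0 v0.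
have [v_gt0|v_le0] := ltrP 0 v.
  have := pos v (- w).
  have -> : v ^+ 2 * u + v * - w * w *+ 2 + (- w) ^+ 2 * v
     = v * (u * v - w ^+ 2) by ring.
  by rewrite pmulr_rge0 // subr_ge0.
have v_eq0 : v = 0 by lra.
have [-> | w_neq0] := eqVneq w 0; first by rewrite v_eq0; lra.
(* The affine expression takes the value -1 at this argument. *)
have := pos 1 (- (u + 1) / (w *+ 2)).
rewrite v_eq0 mulr0 addr0.
have -> : 1 ^+ 2 * u + 1 * (- (u + 1) / (w *+ 2)) * w *+ 2 = - 1.
  by field.
lra.
Qed.

(** A positive semidefinite [A] with [A(z, z) > 0] dominates [d d^T] for
    [d = A z / sqrt (A(z, z))], by Cauchy-Schwarz. Such a [z] exists when
    [A != 0], since a zero diagonal would kill all the entries of [A]. *)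
Lemma psdmx_neq0_rank1 (R : realType) p (A : 'M[R]_p) :
  psdmx A -> A != 0 ->
  exists2 d : 'cV[R]_p, d != 0 & forall x, dot d x ^+ 2 <= bilmx A x x.
Proof.
move=> psdA A0; have [symA _] := psdA.
have [z z_pos] : exists z, 0 < bilmx A z z.
  case/matrix0Pn: A0 => i [j Aij].
  exists (delta_mx j 0); rewrite lt0r (bilmx_ge0 _ psdA) andbT.
  apply: contra_neq Aij => Ajj.
  have := psdmx_cauchy_schwarz (delta_mx i 0) (delta_mx j 0) psdA.
  rewrite Ajj mulr0 /bilmx trmx_delta -rowE -colE !mxE => Aij_le0.
  by apply/eqP; rewrite -sqrf_eq0 eq_le Aij_le0 sqr_ge0.
set s := Num.sqrt (bilmx A z z).
have s_pos : 0 < s by rewrite sqrtr_gt0.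
have dx x : dot (s^-1 *: (A *m z)) x = bilmx A x z / s.
  by rewrite bilmxZl -bilmx_tr trmx1 -bilmx_mulr mul1mx mulrC.
exists (s^-1 *: (A *m z)) => [|x].
  apply/eqP=> d0; have := dx z.
  rewrite d0 /bilmx trmx0 !mul0mx mxE => /esym /eqP.
  by rewrite mulf_eq0 invr_eq0 !gt_eqF.
rewrite dx expr_div_n (sqr_sqrtr (ltW z_pos)) ler_pdivrMr //.
exact: psdmx_cauchy_schwarz.
Qed.

(** * Schur complements *)

Lemma psdmx_block_diag (R : realType) p q (M : 'M[R]_p) (L : 'M[R]_(p, q))
    (S : 'M[R]_q) :
  psdmx (block_mx M L L^T S) -> symmx M /\ psdmx S.
Proof.
move=> psdMLS; have [] := psdMLS; rewrite /symmx tr_block_mx.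
move=> /eq_block_mx[symM _ _ symS] _; split=> //; split=> // xi.
have := bilmx_ge0 (col_mx 0 xi) psdMLS.
by rewrite bilmx_block /bilmx trmx0 !mul0mx !mxE mul0rn !add0r.
Qed.

(** Completing the square in [xi]. *)
Lemma bilmx_schur (R : realType) p q (M : 'M[R]_p) (L : 'M[R]_(p, q))
    (S : 'M[R]_q) x xi (w := invmx S *m (L^T *m x)) :
  symmx S -> S \in unitmx ->
  bilmx (block_mx M L L^T S) (col_mx x xi) (col_mx x xi) =
  bilmx (M - L *m invmx S *m L^T) x x + bilmx S (xi + w) (xi + w).
Proof.
move=> symS unitS.
have Sw y : bilmx S y w = bilmx L x y.
  by rewrite -[S]mul1mx bilmx_mulr mulKVmx // -bilmx_mulr mul1mx bilmx_tr.
rewrite bilmx_block bilmxDm bilmxNm !bilmxDl !bilmxDr (bilmx_sym w xi symS) !Sw.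
by rewrite !bilmx_mulr -/w; ring.
Qed.

Lemma psdmx_schur (R : realType) p q (M : 'M[R]_p) (L : 'M[R]_(p, q))
    (S : 'M[R]_q) :
  psdmx (block_mx M L L^T S) -> S \in unitmx -> psdmx (M - L *m invmx S *m L^T).
Proof.
move=> psdMLS unitS; have [symM [symS _]] := psdmx_block_diag psdMLS.
split=> [|x].
  by rewrite /symmx linearB /= symM !trmx_mul trmxK trmx_inv symS mulmxA.
have := bilmx_ge0 (col_mx x (- (invmx S *m (L^T *m x)))) psdMLS.
by rewrite bilmx_schur // addNr [X in _ + X]/bilmx mulmx0 mxE addr0.
Qed.

(** * Improving a single step *)

(** The slack is a square: with [c = (1 - sg t^2) / (1 + sg t^2)] and
    [s = 2 t / (1 + sg t^2)], which satisfy [c^2 + sg s^2 = 1], it equals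
    [(c a - s b)^2]. *)
Lemma rotation_slack (R : realType) (sg t a b : R)
    (rho := 2 * t / (1 + sg * t ^+ 2) * (a - t * b)) :
  0 <= sg -> 2 * rho * b + sg * rho ^+ 2 <= a ^+ 2.
Proof.
move=> sg0; have den : 1 + sg * t ^+ 2 != 0.
  by rewrite gt_eqF // ltr_wpDr // mulr_ge0 // sqr_ge0.
rewrite -subr_ge0.
suff -> : a ^+ 2 - (2 * rho * b + sg * rho ^+ 2) =
  (((1 - sg * t ^+ 2) * a - 2 * t * b) / (1 + sg * t ^+ 2)) ^+ 2.
  exact: sqr_ge0.
by rewrite /rho; field.
Qed.

(** Let [rho = h . x]. Up to the terms [- 2 rho (y . x) - sg rho^2], the new
    block form at [(x, xi)] is the old one at [(x, xi + rho S^-1 e)]. The old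
    form is at least the Schur complement at [x], hence at least
    [(d . x)^2], which absorbs these terms by [rotation_slack]. *)
Lemma psdmx_rotate (R : realType) p q (M : 'M[R]_p) (L : 'M[R]_(p, q))
    (S : 'M[R]_q) (d : 'cV[R]_p) (e : 'cV[R]_q) (t : R)
    (y := d + L *m (invmx S *m e))
    (alpha := 2 * t / (1 + bilmx S (invmx S *m e) (invmx S *m e) * t ^+ 2))
    (h := alpha *: (d - t *: y)) :
  psdmx (block_mx M L L^T S) -> S \in unitmx ->
  (forall x, dot d x ^+ 2 <= bilmx (M - L *m invmx S *m L^T) x x) ->
  psdmx (block_mx (M - (h *m d^T + d *m h^T)) (L + h *m e^T)
    (L + h *m e^T)^T S).
Proof.
move=> psdMLS unitS d_le; have [symM psdS] := psdmx_block_diag psdMLS.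
have [symS _] := psdS; split.
  rewrite /symmx tr_block_mx trmxK symS; congr block_mx.
  by rewrite linearB linearD /= symM !trmx_mul !trmxK [_ *m _ + _]addrC.
move=> z; rewrite -[z]vsubmxK; move: (usubmx z) (dsubmx z) => x xi {z}.
rewrite -/(bilmx _ _ _) bilmx_block bilmxDm bilmxNm 2!bilmxDm !bilmx_rank1.
pose w := invmx S *m e; pose sg := bilmx S w w.
have Sw z : bilmx S z w = dot e z.
  by rewrite -[S]mul1mx bilmx_mulr mulKVmx // bilmx_sym // /symmx trmx1.
have Lw : dot y x = dot d x + bilmx L x w.
  rewrite bilmxDl; congr (_ + _).
  by rewrite bilmx_sym -?bilmx_mulr ?mul1mx // /symmx trmx1.
have hx : dot h x = alpha * (dot d x - t * dot y x).
  by rewrite bilmxZl -scaleNr bilmxDl bilmxZl mulNr.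
set rho := dot h x in hx *.
have sg_ge0 : 0 <= sg by exact: bilmx_ge0.
have := rotation_slack t (dot d x) (dot y x) sg_ge0; rewrite -/alpha -hx.
have := bilmx_ge0 (xi + rho *: w + invmx S *m (L^T *m x)) psdS.
have := d_le x; have := bilmx_schur M L x (xi + rho *: w) symS unitS.
rewrite bilmx_block Lw bilmxDr bilmxZr !bilmxDl !bilmxDr !bilmxZl !bilmxZr.
rewrite (bilmx_sym w xi symS) !Sw -/sg.
have -> : sg = dot e w by rewrite /sg Sw.
lra.
Qed.

(** A step with nonzero Schur complement is not optimal: the rotation keeps the
    next covariance because [A e = B d], and lowers the cost of the control,
    whose weight is [C], because it moves [M] along [- (d d^T)] to first order
    in [t]. *)
Lemma steering_step_improve (R : realType) (n m : nat) (A : 'M[R]_n)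
    (B : 'M[R]_(n, m)) (C M : 'M[R]_m) (L : 'M[R]_(m, n)) (S : 'M[R]_n) :
  A \in unitmx -> pdmx C -> psdmx (block_mx M L L^T S) -> S \in unitmx ->
  M != L *m invmx S *m L^T ->
  exists M' L',
    [/\ psdmx (block_mx M' L' L'^T S),
        A *m L'^T *m B^T + B *m L' *m A^T + B *m M' *m B^T
        = A *m L^T *m B^T + B *m L *m A^T + B *m M *m B^T
      & \tr (C *m M') < \tr (C *m M)].
Proof.
move=> unitA [symC posC] psdMLS unitS; rewrite -subr_eq0 => V0.
have [d d0 d_le] := psdmx_neq0_rank1 (psdmx_schur psdMLS unitS) V0.
pose e := invmx A *m (B *m d); pose y := d + L *m (invmx S *m e).
pose sg := bilmx S (invmx S *m e) (invmx S *m e).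
have dCd : 0 < bilmx C d d by exact: posC.
(* The direction of [h] is [d - t y]; [t] must be small enough for the term
   [d^T C d] to prevail over [t d^T C y]. *)
pose t := bilmx C d d / (1 + `|bilmx C d y|).
have den_gt0 : 0 < 1 + `|bilmx C d y| by rewrite ltr_pwDl.
have t_gt0 : 0 < t by rewrite divr_gt0.
have t_small : t * bilmx C d y < bilmx C d d.
  apply: le_lt_trans (ler_wpM2l (ltW t_gt0) (ler_norm _)) _.
  by rewrite /t mulrAC ltr_pdivrMr // ltr_pM2l // ltrDr.
have [_ psdS] := psdmx_block_diag psdMLS.
pose alpha := 2 * t / (1 + sg * t ^+ 2).
have alpha_gt0 : 0 < alpha.
  apply: divr_gt0; first exact: mulr_gt0.
  by apply: ltr_wpDr => //; apply: mulr_ge0 (sqr_ge0 _); apply: bilmx_ge0.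
pose h := alpha *: (d - t *: y).
exists (M - (h *m d^T + d *m h^T)), (L + h *m e^T); split.
- exact: psdmx_rotate.
- have eA : e^T *m A^T = d^T *m B^T by rewrite -!trmx_mul mulKVmx.
  have Ae : A *m e = B *m d by rewrite mulKVmx.
  (* [e] has to be opaque, or reassociating products would unfold it. *)
  move: (h) (e) eA Ae => h1 e1 eA Ae.
  rewrite linearD /= trmx_mul trmxK !mulmxDr !mulmxN !mulmxDl !mulNmx.
  rewrite !mulmxDr !mulmxDl !mulmxA Ae -(mulmxA _ e1^T) eA !mulmxA.
  set P := B *m d *m _ *m _; set Q := B *m h1 *m _ *m _.
  move: (A *m _ *m _) (B *m L *m _) (B *m M *m _) P Q => a b c P Q.
  by apply/matrixP => i j; rewrite !mxE; ring.
- rewrite mulmxBr linearB /= gtrBl mulmxDr linearD /= !mxtrace_rank1.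
  rewrite (bilmx_sym h d symC) -mulr2n pmulrn_lgt0 // bilmxZr.
  by rewrite bilmxDr -scaleNr bilmxZr mulr_gt0 // mulNr subr_gt0.
Qed.

Theorem proposition2 (R : realType) (N M n m : nat)
    (hN : (0 < N)%N) (hM : (0 < M)%N) (hn : (0 < n)%N) (hm : (0 < m)%N)
    (D : steering_data R N M n m) (hD : steering_data_wf D)
    (hfeasR : exists v : sdpR_vars R N n m, sdpR_feasible D v)
    (vR : sdpR_vars R N n m) (hoptR : sdpR_optimal D vR)
    (hfeasE : exists v : sdpE_vars R N n m,
        sdpE_feasible D (steering_H D vR) v)
    (hBbar : forall (k : 'I_N) (l : 'I_M), sBbar D k l = 0)
    (hA : forall k : 'I_N, sA D k \in unitmx)
    (vE : sdpE_vars R N n m) (hoptE : sdpE_optimal D (steering_H D vR) vE)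
    (hSigma : forall k : 'I_N, eSigma vE (now k) \in unitmx) :
  forall k : 'I_N,
    eM vE k = eL vE k *m invmx (eSigma vE (now k)) *m (eL vE k)^T.
Proof.
move=> k; apply/eqP/negPn/negP => V0.
have [[symM symS S0 step SN] opt] := hoptE; have [_ posR _ _ _] := hD.
have [M' [L' [psd' cov' cost']]] := steering_step_improve (sB D k)
  (hA k) (posR k) (step k).2 (hSigma k) V0.
(* Only the variables of step [k] change, so that the constraints and the
   costs of all the other steps are untouched. *)
pose v := SdpEVars (fun j => if j == k then L' else eL vE j)
  (fun j => if j == k then M' else eM vE j) (eSigma vE).
suff feas_v : sdpE_feasible D (steering_H D vR) v.
  have := opt v feas_v; apply/negP; rewrite -ltNge /sdpE_cost.
  rewrite (bigD1 k) //= [ltRHS](bigD1 k) //= eqxx.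
  rewrite [X in _ + X < _](eq_bigr
    (fun j => \tr (sR D j *m eM vE j) + \tr (sQ D j *m eSigma vE (now j)))).
    by rewrite !ltrD2r.
  by move=> j /negbTE jk; rewrite /= jk.
split=> // j; rewrite /sdpE_step /v /=; case: (eqVneq j k) => [jk|_] //.
- by have [] := psdmx_block_diag psd'.
- rewrite jk; split=> //; rewrite (step k).1.
  congr (_ + _ + _).
    rewrite -!(addrA (_ *m eSigma vE (now k) *m _)); congr (_ + _); exact/esym.
  by apply: eq_bigr => l _; rewrite hBbar !mul0mx.
- exact: step.
Qed.
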